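(* For every real number $\alpha > 0$ and every positive integer $n$, the harmonic number $H_n = \sum_{k=1}^{n} \frac{1}{k}$ satisfies $$H_n = \sum_{k=1}^{n} \frac{1}{k} = \frac{1}{2} \sum_{k=1}^{n} \left( \int_{-\infty}^{\infty} e^{-\alpha |x|} \operatorname{sech}^{k+1} x \, dx + \frac{\alpha - (k-1)}{k} \int_{-\infty}^{\infty} e^{-(\alpha+1)|x|} \operatorname{sech}^{k} x \, dx \right).$$
   Context: The hyperbolic secant is $\operatorname{sech} x = \frac{1}{\cosh x} = \frac{2e^{x}}{1+e^{2x}}$ for real $x$, and $\operatorname{sech}^{m} x$ denotes $(\operatorname{sech} x)^m$. The $n$-th harmonic number is $H_n = \sum_{k=1}^{n} \frac{1}{k}$ for $n \in \mathbb{N} = \{1,2,3,\dots\}$. *)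

(* Defs.v *)
From mathcomp Require Import all_boot all_order all_algebra.
From mathcomp Require Import all_classical all_reals all_analysis.

Set Implicit Arguments.
Unset Strict Implicit.
Unset Printing Implicit Defensive.

Import Order.TTheory GRing.Theory Num.Theory.
Import numFieldNormedType.Exports.

Local Open Scope ring_scope.

Definition cosh (R : realType) (x : R) : R := (expR x + expR (- x)) / 2.

Definition sech (R : realType) (x : R) : R := 1 / cosh x.

Definition harmonic_number (R : realType) (n : nat) : R :=
  \sum_(1 <= k < n.+1) 1 / k%:R.

(* The integrand is nonnegative, so its Lebesgue integral, taken in [\bar R],
   is the value of the improper integral over the real line, and would be
   [+oo] if the latter diverged. *)
Definition exp_sech_integral (R : realType) (a : R) (m : nat) : \bar R :=
  (\int[@lebesgue_measure R]_x (expR (- a * `|x|) * sech x ^+ m)%:E)%E.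

(* Main.v *)
Require Import Defs.
From mathcomp Require Import all_boot all_order all_algebra.
From mathcomp Require Import all_classical all_reals all_analysis.
From mathcomp Require Import measurable_realfun ring lra.
Import Order.TTheory GRing.Theory Num.Theory.
Import numFieldNormedType.Exports.
Local Open Scope ring_scope.

(** Write [I a m] for the integral of [exp (- a |x|) sech x ^ m] over the
    line.  The identity holds term by term, because for [b > 1] and every
    [k >= 0]
    [[
        k I (b - 1) (k + 1) + (b - k) I b k = 2,
    ]]
    and dividing by [k] at [b = alpha + 1] turns the [k]-th summand into
    [2 / k] ([exp_sech_integral_rec]).  By parity it suffices that the
    half-line integral be [1], and this is the fundamental theorem of
    calculus: from [tanh x = exp x * sech x - 1] one finds that, for [x >= 0],
    the integrand is the derivative of [- exp (- b x) sech x ^ k]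
    ([is_derive_decay_primitive]), which goes from [-1] at [0] to [0] at
    infinity ([integral_decay_rate]).

    The coefficient [b - k] may be negative, so splitting the integral of the
    sum needs both pieces to be integrable.  At [k = 0] nothing has to be
    split, and the computation shows that [b * exp (- b |x|)] has integral
    [2] for every [b > 0]; hence [exp (- b |x|)] is integrable, and it
    dominates [exp (- b |x|) sech x ^ k] since [0 < sech <= 1]
    ([integrable_decay]). *)

(** * The hyperbolic secant *)

Lemma cosh_ge1 (R : realType) (x : R) : 1 <= cosh x.
Proof.
rewrite /cosh ler_pdivlMr// mul1r.
by have := expR_ge1Dx x; have := expR_ge1Dx (- x); lra.
Qed.

Lemma cosh_neq0 (R : realType) (x : R) : cosh x != 0.
Proof. by rewrite gt_eqF// (lt_le_trans _ (cosh_ge1 R x)). Qed.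

Lemma sech_gt0 (R : realType) (x : R) : 0 < sech x.
Proof. by rewrite /sech div1r invr_gt0 (lt_le_trans _ (cosh_ge1 R x)). Qed.

Lemma sech_le1 (R : realType) (x : R) : sech x <= 1.
Proof.
by rewrite /sech div1r invf_le1 ?cosh_ge1// (lt_le_trans _ (cosh_ge1 R x)).
Qed.

Lemma sech0 (R : realType) : sech (0 : R) = 1.
Proof. by rewrite /sech /cosh oppr0 expR0; field. Qed.

Lemma sech_norm (R : realType) (x : R) : sech `|x| = sech x.
Proof.
by have [_|_] := ger0P x => //; rewrite /sech /cosh opprK addrC.
Qed.

Lemma sech_mul_expR_ge1 (R : realType) (x : R) : 0 <= x -> 1 <= expR x * sech x.
Proof.
move=> x0; rewrite /sech div1r ler_pdivlMr ?(lt_le_trans _ (cosh_ge1 R x))//.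
rewrite mul1r /cosh ler_pdivrMr//.
have : expR (- x) <= expR x by rewrite ler_expR; lra.
by lra.
Qed.

(** The factor [expR x * sech x - 1] is [tanh x], written so that
    differentiation stays among products of exponentials and powers of
    [sech]. *)
Lemma is_derive_sech (R : realType) (x : R) :
  is_derive x 1 (@sech R) (- (sech x * (expR x * sech x - 1))).
Proof.
have dc : is_derive x 1 (@cosh R) ((expR x - expR (- x)) / 2).
  rewrite (_ : @cosh R = (fun x => 2^-1 *: (expR x + expR (- x)))); last first.
    by apply/funext => y; rewrite /cosh mulrC.
  apply: is_derive_eq; rewrite /GRing.scale/=; ring.
rewrite (_ : @sech R = (fun x => (cosh x)^-1)); last first.
  by apply/funext => y; rewrite /sech div1r.
have dv := is_deriveV (cosh_neq0 R x) dc.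
apply: (is_derive_eq dv); rewrite /GRing.scale/=.
have := cosh_neq0 R x; rewrite /cosh => h.
field.
by move: h; rewrite mulf_eq0 negb_or => /andP[].
Qed.

(** * Exponentials times powers of the hyperbolic secant *)

Definition decay {R : realType} (b : R) (k : nat) (x : R) : R :=
  expR (- b * x) * sech x ^+ k.

Lemma decay_ge0 (R : realType) (b : R) k x : 0 <= decay b k x.
Proof. by rewrite mulr_ge0 ?expR_ge0// exprn_ge0// ltW// sech_gt0. Qed.

Lemma decay_le_expR (R : realType) (b : R) k x : decay b k x <= expR (- b * x).
Proof.
rewrite ler_piMr ?expR_ge0//.
by rewrite exprn_ile1 ?sech_le1// ltW// sech_gt0.
Qed.

(** Each factor [exp x] coming from [tanh x = exp x * sech x - 1] lowers [b]
    by one while [sech x] raises the power [k] by one. *)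
Lemma is_derive_decay (R : realType) (b : R) k (x : R) :
  is_derive x 1 (decay b k)
    (- (k%:R * decay (b - 1) k.+1 x + (b - k%:R) * decay b k x)).
Proof.
have ds := is_derive_sech R x.
have de : is_derive x 1 (fun y => expR (- b * y)) (- b * expR (- b * x)).
  have dl : is_derive x 1 (fun y : R => - b *: y) (- b).
    by apply: is_derive_eq; rewrite /GRing.scale/= mulr1.
  have dc := is_derive1_comp (is_derive_expR (- b *: x)) dl.
  by apply: (is_derive_eq dc); rewrite mulrC.
have dE : decay b k = (fun y => expR (- b * y)) * (@sech R) ^+ k.
  by apply/funext => y; rewrite exprfctE.
rewrite [X in is_derive _ _ X _]dE.
apply: (is_derive_eq (is_deriveM de (is_deriveX k ds))).
rewrite exprfctE /decay /GRing.scale/= {dE}.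
rewrite (_ : - (b - 1) * x = - b * x + x); last by ring.
rewrite expRD.
case: k => [|k]; first by rewrite !mul0r !expr0; ring.
by rewrite !exprS -[k.+1.-1]/k -natr1; ring.
Qed.

Lemma continuous_decay (R : realType) (b : R) k : continuous (decay b k).
Proof.
move=> x; apply/differentiable_continuous/derivable1_diffP.
by have [] := is_derive_decay R b k x.
Qed.

Lemma cvg_decay (R : realType) (b : R) k : 0 < b ->
  (decay b k x @[x --> +oo%R] --> (0 : R))%classic.
Proof.
move=> b0; apply: (@squeeze_cvgr _ _ _ _ (fun=> 0) (fun x => expR (- (b * x)))).
- by near=> x; rewrite decay_ge0 -mulNr decay_le_expR.
- exact: cvg_cst.
- apply: (cvg_comp (fun x => b * x) (fun x => expR (- x))); last exact: cvgr_expR.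
  exact: gt0_cvgMry.
Unshelve. all: by end_near. Qed.

(** Minus the derivative of [decay b k]; at [b = alpha + 1] the two
    exponents are those of the two integrals in the [k]-th summand. *)
Definition decay_rate {R : realType} (b : R) (k : nat) (x : R) : R :=
  k%:R * decay (b - 1) k.+1 x + (b - k%:R) * decay b k x.

Lemma is_derive_decay_primitive (R : realType) (b : R) k (x : R) :
  is_derive x 1 (- decay b k) (decay_rate b k x).
Proof.
have dd := is_derive_decay R b k x.
by apply: is_derive_eq; rewrite opprK.
Qed.

(** For [x >= 0] the rate [(b + k tanh x) * decay b k x] is nonnegative even
    when [b - k < 0]; this allows computing its integral on the half line by
    the limit of a primitive. *)
Lemma decay_rate_ge0 (R : realType) (b : R) k (x : R) : 0 < b -> 0 <= x ->
  0 <= decay_rate b k x.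
Proof.
move=> b0 x0.
have -> : decay_rate b k x =
    decay b k x * (b + k%:R * (expR x * sech x - 1)).
  rewrite /decay_rate /decay (_ : - (b - 1) * x = - b * x + x); last by ring.
  by rewrite expRD exprS; ring.
rewrite mulr_ge0 ?decay_ge0// addr_ge0 ?(ltW b0)// mulr_ge0//.
by rewrite subr_ge0 sech_mul_expR_ge1.
Qed.

Lemma continuous_decay_rate (R : realType) (b : R) k : continuous (decay_rate b k).
Proof.
move=> x; apply: cvgD; apply: cvgM; try exact: cvg_cst;
  exact: continuous_decay.
Qed.

(** * Integrals over the line *)

Lemma integral_decay_rate (R : realType) (b : R) k : 0 < b ->
  (\int[@lebesgue_measure R]_x (decay_rate b k `|x|)%:E = 2%:E)%E.
Proof.
move=> b0.
have cr : continuous (fun x : R => decay_rate b k `|x|).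
  move=> x; apply: (continuous_comp (f := fun y : R => `|y|)).
    exact: norm_continuous.
  exact: continuous_decay_rate.
rewrite (ge0_symfun_integralT _ cr); last 2 first.
- by move=> x; rewrite decay_rate_ge0.
- by move=> x /=; rewrite normrN.
suff half : (\int[@lebesgue_measure R]_(x in `[0%R, +oo[%classic)
    (decay_rate b k x)%:E = 1)%E.
  rewrite -[RHS]mule1 -half -set_itvcy; congr (_ * _)%E.
  by apply: eq_integral => x; rewrite inE/= in_itv/= andbT => x0; rewrite ger0_norm.
rewrite (@ge0_continuous_FTC2y _ (decay_rate b k) (- decay b k) 0 0).
- rewrite /decay !fctE mulr0 expR0 sech0 expr1n mulr1.
  by rewrite -EFinB sub0r opprK.
- by move=> x; exact: decay_rate_ge0.
- exact/continuous_subspaceT/continuous_decay_rate.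
- by rewrite -oppr0; apply: cvgN; exact: cvg_decay.
- by move=> x _; have [] := is_derive_decay_primitive R b k x.
- by apply: cvg_at_right_filter; apply: cvgN; exact: continuous_decay.
- move=> x _; rewrite derive1E.
  by have [_ ->] := is_derive_decay_primitive R b k x.
Qed.

Lemma measurable_decay_norm (R : realType) (b : R) k :
  measurable_fun [set: R] (fun x => decay b k `|x|).
Proof.
apply: measurableT_comp; last exact: normr_measurable.
by apply: continuous_measurable_fun; exact: continuous_decay.
Qed.

Lemma integrable_decay (R : realType) (b : R) k : 0 < b ->
  (@lebesgue_measure R).-integrable [set: R]
    (fun x => (decay b k `|x|)%:E).
Proof.
move=> b0.
have i0 : (@lebesgue_measure R).-integrable [set: R]
    (fun x => (decay_rate b 0 `|x|)%:E).
  apply/integrableP; split.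
    apply/measurable_EFinP; apply: measurableT_comp; last exact: normr_measurable.
    by apply: continuous_measurable_fun; exact: continuous_decay_rate.
  under eq_integral => x _ do rewrite gee0_abs ?lee_fin ?decay_rate_ge0//.
  by rewrite integral_decay_rate// ltry.
(* [decay_rate b 0] is [b * expR (- b * x)]. *)
apply: le_integrable (integrableZl measurableT b^-1 i0) => //.
  by apply/measurable_EFinP; exact: measurable_decay_norm.
move=> x _; rewrite -EFinM !abse_EFin lee_fin.
rewrite /decay_rate mul0r add0r subr0 mulKf ?gt_eqF//.
rewrite (ger0_norm (decay_ge0 _ _ k _)) (ger0_norm (decay_ge0 _ _ 0 _)).
by rewrite [leRHS]/decay expr0 mulr1 decay_le_expR.
Qed.

Lemma exp_sech_integralE (R : realType) (b : R) k :
  exp_sech_integral b k =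
  (\int[@lebesgue_measure R]_x (decay b k `|x|)%:E)%E.
Proof. by apply: eq_integral => x _; rewrite /decay sech_norm. Qed.

Lemma exp_sech_integral_fin_num (R : realType) (b : R) k : 0 < b ->
  exp_sech_integral b k \is a fin_num.
Proof.
move=> b0; rewrite exp_sech_integralE.
by apply: integrable_fin_num => //; exact: integrable_decay.
Qed.

(** This is [integral_decay_rate] split into its two summands; with
    [b - 1 > 0] both are integrable, so no [+oo - oo] can arise when
    [b - k] is negative. *)
Lemma exp_sech_integral_rec (R : realType) (b : R) k : 1 < b ->
  (k%:R%:E * exp_sech_integral (b - 1) k.+1
   + (b - k%:R)%:E * exp_sech_integral b k = 2%:E)%E.
Proof.
move=> b1; have b0 : 0 < b by apply: lt_trans b1.
have b10 : 0 < b - 1 by rewrite subr_gt0.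
rewrite -(integral_decay_rate _ _ k b0) !exp_sech_integralE.
rewrite -!integralZl//; try exact: integrable_decay.
by rewrite -integralD//; apply: integrableZl => //; exact: integrable_decay.
Qed.

Theorem proposition1 (R : realType) (alpha : R) (n : nat)
    (alpha_gt0 : 0 < alpha) (n_gt0 : (0 < n)%N) :
  ((harmonic_number R n)%:E =
   (1 / 2)%:E * \sum_(1 <= k < n.+1)
     (exp_sech_integral alpha k.+1
      + ((alpha - (k%:R - 1)) / k%:R)%:E * exp_sech_integral (alpha + 1) k))%E.
Proof.
have term k : (0 < k)%N -> (exp_sech_integral alpha k.+1
      + ((alpha - (k%:R - 1)) / k%:R)%:E * exp_sech_integral (alpha + 1) k
      = (2 * (1 / k%:R))%:E)%E.
  move=> k0; have kn0 : k%:R != 0 :> R by rewrite pnatr_eq0 -lt0n.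
  have a1 : 1 < alpha + 1 by rewrite ltrDr.
  have a10 : 0 < alpha + 1 by apply: lt_trans a1.
  have := exp_sech_integral_rec R (alpha + 1) k a1; rewrite addrK.
  rewrite -(fineK (exp_sech_integral_fin_num R alpha k.+1 alpha_gt0)).
  rewrite -(fineK (exp_sech_integral_fin_num R (alpha + 1) k a10)).
  rewrite -!EFinM -!EFinD => -[<-]; congr EFin.
  by field.
rewrite (eq_big_nat _ _ (F2 := fun k => (2 * (1 / k%:R))%:E)); last first.
  by move=> k /andP[k1 _]; exact: term.
rewrite sumEFin -EFinM -mulr_sumr /harmonic_number; congr EFin.
by field.
Qed.
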